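(* Let $q$ be an odd prime power and $n$ a positive integer. There are constants $C_0,c>0$ (independent of $q$ and $A$) such that for every $A\subset M_n(\mathbb{F}_q)$ with $|A|\ge C_0\, q^{n^2-1}$, \[ \max\{|A+A|,|AA|\} \ge c\,\min\left\{\frac{|A|^2}{q^{n^2-1/2}},\; q^{n^2/2}|A|^{1/2}\right\}.\]
   Context: $M_n(\mathbb{F}_q)$ is the ring of $n\times n$ matrices over $\mathbb{F}_q$; $A+A=\{a+b:a,b\in A\}$ and $AA=\{ab: a,b\in A\}$. *)

(* Defs.v *)
From mathcomp Require Import all_boot all_order all_algebra.

Set Implicit Arguments.
Unset Strict Implicit.
Unset Printing Implicit Defensive.

Import GRing.Theory.
Local Open Scope ring_scope.

Definition sumset (F : finFieldType) (n : nat) (A B : {set 'M[F]_n})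
  : {set 'M[F]_n} := [set a + b | a in A, b in B].

(* [*m] rather than [*], so that the size need not be a syntactic successor. *)
Definition prodset (F : finFieldType) (n : nat) (A B : {set 'M[F]_n})
  : {set 'M[F]_n} := [set a *m b | a in A, b in B].

(* Main.v *)
(* For a, b, c in A with a invertible, the point (ac, b + c) of AA x (A + A)
   lies on the "line" x = a (y - b).  Two such lines (a, b), (a', b') meet in
   exactly one point unless a - a' is singular, and for fixed (a, b) the lines
   with a - a' singular meet it in at most s q^(n^2) points in total, where
   s = O(q^(n^2-1)) is the number of singular matrices.  Hence the number of
   lines through a point has small variance, and Cauchy-Schwarz bounds its
   deviation from the mean over AA x (A + A). *)
Require Import Defs.
From mathcomp Require Import all_boot all_order all_algebra.
From mathcomp Require Import reals exp.
From mathcomp Require Import zify ring lra.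

Set Implicit Arguments.
Unset Strict Implicit.
Unset Printing Implicit Defensive.

Import Order.TTheory GRing.Theory Num.Theory.
Local Open Scope ring_scope.

Definition singular (F : finFieldType) (n : nat) : {set 'M[F]_n} :=
  [set M | M \notin unitmx].

Lemma prod_expn_sub1_le (q n : nat) :
  (\prod_(1 <= i < n.+1) (q ^ i - 1) <= q ^ 'C(n.+1, 2))%N.
Proof.
elim: n => [|n IHn]; first by rewrite big_geq.
by rewrite binS bin1 expnD big_nat_recr // leq_mul // leq_subr.
Qed.

(** Dividing by [q * q ^ 'C(n.+1, 2)] turns this into the union bound: the product of the [1 - q^-i]
    is at least [1 - n/q], each factor losing at most [1/q]. *)
Lemma leq_prod_expn_sub1 (q n : nat) : (0 < q)%N ->
  (q * q ^ 'C(n.+1, 2)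
    <= q * \prod_(1 <= i < n.+1) (q ^ i - 1) + n * q ^ 'C(n.+1, 2))%N.
Proof.
move=> q_gt0; elim: n => [|n IHn]; first by rewrite big_geq // addn0.
have P_le := prod_expn_sub1_le q n.
rewrite binS bin1 expnD big_nat_recr //.
set P := (\prod_(_ <= _ < _) _)%N in IHn P_le *; set t := (q ^ _)%N in IHn P_le *.
set s := (q ^ n.+1)%N.
have q_le : (q <= s)%N by rewrite -[leqLHS]expn1 leq_pexp2l.
(* The new factor [s - 1] loses [q * P], which one more copy of [t * s] absorbs. *)
have qP_le : (q * P <= t * s)%N by rewrite mulnC leq_mul.
have IHs : (q * t * s <= (q * P + n * t) * s)%N by rewrite leq_mul2r IHn orbT.
rewrite /= [(P * _)%N]mulnBr muln1 mulnBr; nia.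
Qed.

(* Multiplying by q avoids the truncated exponent n^2 - 1. *)
Lemma card_singular (F : finFieldType) (n : nat) :
  (#|F| * #|singular F n| <= n * #|F| ^ (n * n))%N.
Proof.
case: n => [|n].
  rewrite mul0n leqn0 muln_eq0 cards_eq0; apply/orP; right.
  by apply/eqP/setP=> M; rewrite !inE unitmxE det_mx00 unitr1.
have q_gt0 : (0 < #|F|)%N by rewrite (cardD1 0).
have cGL : #|~: singular F n.+1| = #|'GL_n.+1[F]%g|.
  rewrite cardsT card_sub; apply: eq_card => M.
  by rewrite !inE negbK.
have := cardsC (singular F n.+1); rewrite cGL card_mx card_GL //.
(* The first power is a factor of the order of GL; the second is compared with the product [P]. *)
have -> : (n.+1 * n.+1 = 'C(n.+1, 2) + 'C(n.+2, 2))%N.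
  rewrite (binS n.+1) bin1 addnA addnn bin2 even_halfK ?oddM /= ?andNb //.
  by rewrite -mulnSr.
rewrite expnD; set P := (\prod_(_ <= _ < _) _)%N.
have := leq_prod_expn_sub1 n.+1 q_gt0; rewrite -/P => P_ge card_sum.
rewrite -(leq_add2r (#|F| * (#|F| ^ 'C(n.+1, 2) * P))) -mulnDr card_sum.
by rewrite mulnCA addnC [X in (_ <= X + _)%N]mulnCA [X in (_ <= _ + X)%N]mulnCA
  -mulnDr leq_mul.
Qed.

Lemma sum_sqrB (R : realFieldType) (T : finType) (A : {pred T}) (f : T -> R) (m : R) :
  \sum_(x in A) (f x - m) ^+ 2 =
    \sum_(x in A) f x ^+ 2 - 2 * m * \sum_(x in A) f x + #|A|%:R * m ^+ 2.
Proof.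
rewrite (eq_bigr (fun x => f x ^+ 2 - 2 * m * f x + m ^+ 2)) => [|x _]; last by ring.
by rewrite !big_split /= sumrN -mulr_sumr sumr_const -[m ^+ 2 *+ _]mulr_natl.
Qed.

(** Cauchy-Schwarz against the constant 1, read off from the variance about the mean [m] being
    nonnegative. *)
Lemma sqr_sum_le (R : realFieldType) (T : finType) (P : {set T}) (f : T -> R) :
  (\sum_(x in P) f x) ^+ 2 <= #|P|%:R * \sum_(x in P) f x ^+ 2.
Proof.
have [->|P_neq0] := eqVneq P set0; first by rewrite !big_set0 mulr0 expr0n.
have P_gt0 : 0 < #|P|%:R :> R by rewrite ltr0n card_gt0.
set s := \sum_(x in P) f x; set m := s / #|P|%:R.
have : 0 <= \sum_(x in P) (f x - m) ^+ 2 by apply: sumr_ge0 => x _; exact: sqr_ge0.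
rewrite sum_sqrB -/s => var_ge0.
have -> : s ^+ 2 = #|P|%:R * (s ^+ 2 / #|P|%:R) by field; rewrite gt_eqF.
rewrite ler_pM2l //.
suff : \sum_(x in P) f x ^+ 2 - 2 * m * s + #|P|%:R * m ^+ 2
   = \sum_(x in P) f x ^+ 2 - s ^+ 2 / #|P|%:R by lra.
by rewrite /m; field; rewrite gt_eqF.
Qed.

(** Over all [Q * Q] points, the number of lines through a point has mean [#|L| / Q]. The pair count
    is its second moment, so its squared deviations sum to at most [S]; Cauchy-Schwarz on [P]
    concludes. *)
Lemma incidence_second_moment (R : realFieldType) (T U : finType)
    (inc : T -> U -> bool) (P : {set T}) (L : {set U}) (Q S : nat) :
    #|T| = (Q * Q)%N -> (0 < Q)%N ->
    (forall l, l \in L -> #|[set p | inc p l]| = Q) ->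
    (\sum_(l in L) \sum_(l' in L) #|[set p | inc p l && inc p l']|
      <= #|L| * #|L| + S)%N ->
  (\sum_(p in P) #|[set l in L | inc p l]|%:R - #|P|%:R * #|L|%:R / Q%:R) ^+ 2
    <= #|P|%:R * S%:R :> R.
Proof.
move=> cT Q_gt0 cinc cinc2.
have Q_neq0 : Q%:R != 0 :> R by rewrite pnatr_eq0 -lt0n.
pose i p : R := #|[set l in L | inc p l]|%:R.
have iE p : i p = \sum_(l in L) (inc p l)%:R.
  rewrite /i -sum1_card natr_sum big_mkcond [RHS]big_mkcond /=.
  by apply: eq_bigr => l _; rewrite inE; case: (l \in L); case: (inc p l).
have cardE (A : pred T) : #|[set p | A p]|%:R = \sum_p (A p)%:R :> R.
  rewrite -sum1_card natr_sum big_mkcond /=.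
  by apply: eq_bigr => l _; rewrite inE; case: (A l).
set m := #|L|%:R / Q%:R : R.
have -> : \sum_(p in P) i p - #|P|%:R * #|L|%:R / Q%:R = \sum_(p in P) (i p - m).
  by rewrite big_split /= sumrN sumr_const -[m *+ _]mulr_natl mulrA.
apply: le_trans (sqr_sum_le _ _) _; apply: ler_wpM2l; first exact: ler0n.
(* Enlarging [P] to the whole space only adds squares, and there both moments are known. *)
apply: (@le_trans _ _ (\sum_p (i p - m) ^+ 2)).
  by rewrite [leRHS](bigID [in P]) /= lerDl sumr_ge0 // => p _; exact: sqr_ge0.
have sum1 : \sum_p i p = #|L|%:R * Q%:R.
  under eq_bigr do rewrite iE.
  rewrite exchange_big /= mulr_natl -sumr_const; apply: eq_bigr => l lL.
  by rewrite -cardE cinc.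
have sum2 : \sum_p i p ^+ 2 <= #|L|%:R ^+ 2 + S%:R.
  rewrite expr2 -natrM -natrD; apply: le_trans (_ : _ <= (_)%:R) _; last first.
    by rewrite ler_nat; exact: cinc2.
  rewrite natr_sum; under [leRHS]eq_bigr do rewrite natr_sum.
  under [leRHS]eq_bigr do under eq_bigr do rewrite cardE.
  under [leLHS]eq_bigr do rewrite expr2 iE big_distrlr /=.
  rewrite exchange_big /= ler_sum // => l _.
  rewrite exchange_big /= ler_sum // => l' _.
  by apply: ler_sum => p _; rewrite -natrM mulnb.
rewrite sum_sqrB sum1 cT natrM /m.
have -> : Q%:R * Q%:R * (#|L|%:R / Q%:R) ^+ 2 = #|L|%:R ^+ 2 :> R by field.
have -> : 2 * (#|L|%:R / Q%:R) * (#|L|%:R * Q%:R) = 2 * #|L|%:R ^+ 2 :> R by field.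
lra.
Qed.

Definition on_line (F : finFieldType) (n : nat) (p l : 'M[F]_n * 'M[F]_n) : bool :=
  p.1 == l.1 *m (p.2 - l.2).

(** Every line is a graph over the second coordinate, so its points are parametrized by [y]. *)
Lemma card_on_line (F : finFieldType) (n : nat) (l : 'M[F]_n * 'M[F]_n)
    (B : {pred 'M[F]_n * 'M[F]_n}) :
  #|[set p | on_line p l && B p]| = #|[set y | B (l.1 *m (y - l.2), y)]|.
Proof.
pose f y := (l.1 *m (y - l.2), y).
have f_inj : injective f by move=> y y' [_ ->].
rewrite -(card_imset _ f_inj); apply: eq_card => -[x y]; rewrite !inE.
apply/andP/imsetP => [[/eqP /= -> By]|[y']]; first by exists y; rewrite ?inE.
by rewrite inE => By' [-> ->]; split; first exact: eqxx.
Qed.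

Lemma card_affine_le1 (F : finFieldType) (n : nat) (a c : 'M[F]_n) :
  a \in unitmx -> (#|[set y | a *m y == c]| <= 1)%N.
Proof.
move=> Ua; rewrite -(cards1 (invmx a *m c)) subset_leq_card //.
by apply/subsetP => y; rewrite !inE => /eqP <-; rewrite mulKmx.
Qed.

(** If [a - a'] is invertible, a common point solves [(a - a') y = a b - a' b'], so there is at most
    one. Otherwise one pair may share many points, but summing over [b'] helps: given [y],
    invertibility of [a'] determines [b']. *)
Lemma card_line_crossings (F : finFieldType) (n : nat) (G B : {set 'M[F]_n})
    (l : 'M[F]_n * 'M[F]_n) :
  {in G, forall a, a \in unitmx} ->
  (\sum_(l' in setX G B) #|[set p | on_line p l && on_line p l']|
    <= #|setX G B| + #|singular F n| * #|{: 'M[F]_n}|)%N.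
Proof.
move=> GU; case: l => a b.
rewrite (bigID (fun l' => a - l'.1 \in unitmx)) /= leq_add //.
  rewrite -sum1_card [leqRHS](bigID (fun l' => a - l'.1 \in unitmx)) /=.
  apply: leq_trans (leq_addr _ _); apply: leq_sum => -[a' b'] /andP[_ /= Ud].
  rewrite card_on_line /on_line /=.
  apply: leq_trans (card_affine_le1 (a *m b - a' *m b') Ud).
  apply/subset_leq_card/subsetP => y; rewrite !inE /= => /eqP eq_y.
  move: eq_y; rewrite mulmxBl !mulmxBr => eq_y; apply/eqP.
  rewrite -[a *m y](subrK (a *m b)) eq_y [a' *m y - _]addrC.
  by rewrite addrAC addrK addrC.
apply: (@leq_trans (\sum_(a' | (a' \in G) && ((a - a')%R \in singular F n))
    \sum_b' \sum_y (a *m (y - b)%R == a' *m (y - b')%R))).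
  rewrite [leqRHS]pair_big /= big_mkcond [leqRHS]big_mkcond /=.
  apply: leq_sum => -[a' b'] _ /=; rewrite !inE /= andbT.
  case: (a' \in G) => //=; case: (b' \in B) => //=; case: (_ \in unitmx) => //=.
  by rewrite card_on_line -sum1_card big_mkcond leq_sum // => y _; rewrite !inE.
apply: (@leq_trans (\sum_(a' | (a' \in G) && ((a - a')%R \in singular F n))
    #|{: 'M[F]_n}|)).
  apply: leq_sum => a' /andP[/GU Ua' _]; rewrite exchange_big /= -sum1_card.
  apply: leq_sum => y _.
  apply: leq_trans (card_affine_le1 (a' *m y - a *m (y - b)) Ua').
  rewrite -sum1_card [leqRHS]big_mkcond leq_sum // => b' _; rewrite !inE.
  by case: eqP => //= ->; rewrite mulmxBr subKr eqxx.
rewrite sum_nat_const leq_mul2r; apply/orP; right.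
rewrite (leq_trans _ (leq_imset_card (fun d => a - d) (mem (singular F n)))) //.
apply/subset_leq_card/subsetP => a' /andP[_ sing_d].
by apply/imsetP; exists (a - a') => //; rewrite subKr.
Qed.

(** There are at least [#|L| * #|A|] incidences. Either the expected number [p * #|L| / Q] is at
    least half of this, or the deviation is, and then the second moment bound with
    [S = #|L| * s * Q] applies. *)
Lemma sum_product_dichotomy (F : finFieldType) (n : nat) (A : {set 'M[F]_n}) :
  let p := (#|prodset A A| * #|sumset A A|)%N in
  let Q := #|{: 'M[F]_n}| in
  (#|A| * Q <= 2 * p)%N \/
  (#|A :\: singular F n| * #|A| ^ 3 <= 4 * p * #|singular F n| * Q)%N.
Proof.
set G := A :\: singular F n => p Q.
have GU : {in G, forall a, a \in unitmx} by move=> a; rewrite !inE negbK => /andP[].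
set s := #|singular F n|.
pose P := setX (prodset A A) (sumset A A); pose L := setX G A.
have cL : #|L| = (#|G| * #|A|)%N by rewrite cardsX.
have [L0|L_gt0] := posnP #|L|.
  by right; rewrite expnS mulnA -cL L0 mul0n.
have Q_gt0 : (0 < Q)%N by rewrite /Q (cardD1 0).
have cP : #|P| = p by rewrite cardsX.
have cline l : l \in L -> #|[set z | on_line z l]| = Q.
  move=> _; have := card_on_line l predT.
  have -> : [set z | on_line z l && predT z] = [set z | on_line z l].
    by apply/setP => z; rewrite !inE andbT.
  by move=> ->; apply: eq_card => y; rewrite !inE.
have moment : (\sum_(l in L) \sum_(l' in L) #|[set z | on_line z l && on_line z l']|
    <= #|L| * #|L| + #|L| * (s * Q))%N.
  rewrite -mulnDr -sum_nat_const; apply: leq_sum => l _.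
  exact: card_line_crossings.
have cT : #|{: 'M[F]_n * 'M[F]_n}| = (Q * Q)%N by rewrite card_prod.
have := incidence_second_moment rat P cT Q_gt0 cline moment.
set J := \sum_(z in P) _; rewrite cP => J_le.
(* Swap the sums: the line [(a, b)] contains the points [(a c, b + c)] of [P], distinct for distinct
   [c] in [A]. *)
have J_ge : (#|L| * #|A|)%:R <= J.
  rewrite /J -natr_sum ler_nat -sum_nat_const.
  under [leqRHS]eq_bigr do rewrite -sum1_card big_mkcond.
  rewrite exchange_big /= [leqRHS](bigID [in L]) /=.
  apply: leq_trans (leq_addr _ _); apply: leq_sum => -[a b] abL.
  move: (abL); rewrite inE => /andP[/= /setDP[aA _] bA].
  apply: (@leq_trans #|[set z | on_line z (a, b) && (z \in P)]|).
    rewrite card_on_line /= -(card_imset A (@addrI _ b)) subset_leq_card //.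
    apply/subsetP => _ /imsetP[c cA ->]; rewrite !inE /= [b + c]addrC addrK.
    by apply/andP; split; apply/imset2P; [exists a c | exists c b].
  rewrite -sum1_card big_mkcond [leqRHS]big_mkcond leq_sum // => z _.
  by rewrite inE [_ \in [set _ in L | _]]inE abL andbC; case: (z \in P).
have [?|lt_p] := leqP (#|A| * Q) (2 * p); [by left | right].
have Q_gt0' : 0 < Q%:R :> rat by rewrite ltr0n.
have L_gt0' : 0 < #|L|%:R :> rat by rewrite ltr0n.
have mean_le : p%:R * #|L|%:R / Q%:R <= #|L|%:R * #|A|%:R / 2 :> rat.
  rewrite ler_pdivrMr // mulrC -!mulrA ler_pM2l //.
  have : (2 * p)%:R <= (#|A| * Q)%:R :> rat by rewrite ler_nat ltnW.
  by rewrite !natrM; lra.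
have dev_ge : #|L|%:R * #|A|%:R / 2 <= J - p%:R * #|L|%:R / Q%:R :> rat.
  by rewrite natrM in J_ge; lra.
have : (#|L|%:R * #|A|%:R / 2) ^+ 2 <= p%:R * (#|L| * (s * Q))%:R :> rat.
  apply: le_trans J_le; rewrite lerXn2r ?nnegrE //.
    by rewrite divr_ge0 ?mulr_ge0.
  by apply: le_trans dev_ge; rewrite divr_ge0 ?mulr_ge0.
have -> : (#|L|%:R * #|A|%:R / 2) ^+ 2 = #|L|%:R * ((#|L| * #|A| ^ 2)%:R / 4) :> rat.
  by rewrite natrM natrX; field.
rewrite [(#|L| * (s * Q))%:R]natrM [leRHS]mulrCA ler_pM2l // ler_pdivrMr // => le_L.
rewrite -(ler_nat rat) expnS mulnA -cL; apply: le_trans le_L _.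
by rewrite !natrM; lra.
Qed.

(* MathComp / MathComp-Analysis.  A field with q elements exists only for q a
   prime power, so that [#|F| = q] and [odd q] make q an odd prime power. *)
Theorem theorem1p14 (R : realType) (n : nat) (hn : (0 < n)%N) :
  exists C0 c : R, 0 < C0 /\ 0 < c /\
    forall (q : nat) (F : finFieldType), odd q -> #|F| = q ->
    forall A : {set 'M[F]_n},
      C0 * q%:R ^+ (n ^ 2 - 1)%N <= #|A|%:R ->
      c * Num.min (#|A|%:R ^+ 2 / (q%:R `^ ((n ^ 2)%N%:R - 1 / 2)))
                  (q%:R `^ ((n ^ 2)%N%:R / 2) * #|A|%:R `^ (1 / 2))
        <= Num.max #|sumset A A|%:R #|prodset A A|%:R.
Proof.
have n_gt0 : 0 < n%:R :> R by rewrite ltr0n.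
have n_ge1 : 1 <= n%:R :> R by rewrite ler1n.
(* There are at most [n * q ^ (n ^ 2 - 1)] singular matrices, so [C0 = 2n] leaves at least half of
   [A] invertible. The factor [8n] is 4 from the dichotomy, 2 from this halving and [n] from the
   singular count. *)
exists (2 * n%:R), (8 * n%:R)^-1; split; first by rewrite mulr_gt0.
split; first by rewrite invr_gt0 mulr_gt0.
move=> q F _ cF A A_ge; rewrite -natrX -!natrM ler_nat in A_ge.
have q_gt0 : (0 < q)%N by rewrite -cF (cardD1 0).
have N_gt0 : (0 < n ^ 2)%N by rewrite expn_gt0 hn.
set t := (q ^ (n ^ 2 - 1))%N in A_ge *.
have t_gt0 : (0 < t)%N by rewrite expn_gt0 q_gt0.
have Qt : (q ^ (n ^ 2) = q * t)%N by rewrite -expnS subn1 prednK.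
have Q_gt0 : (0 < q ^ (n ^ 2))%N by rewrite expn_gt0 q_gt0.
have sing_le : (#|singular F n| <= n * t)%N.
  by rewrite -(leq_pmul2l q_gt0) -cF (leq_trans (card_singular F n)) // cF mulnn Qt mulnCA.
have G_ge : (#|A| <= 2 * #|A :\: singular F n|)%N.
  have := cardsID (singular F n) A.
  have := subset_leq_card (subsetIr A (singular F n)).
  by lia.
set M := Num.max _ _; set X := _ / _; set Y := _ `^ _ * _.
have M_ge0 : 0 <= M by rewrite le_max ler0n.
have p_le : (#|prodset A A| * #|sumset A A|)%:R <= M ^+ 2.
  by rewrite natrM expr2 ler_pM // le_max lexx ?orbT.
(* Since [8n] is at least 1, it may be squared, which avoids a square root in the constant. *)
have le_M (x : R) : 0 <= x -> x ^+ 2 <= (8 * n%:R) * M ^+ 2 -> (8 * n%:R)^-1 * x <= M.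
  move=> x_ge0 le_x; rewrite mulrC ler_pdivrMr ?mulr_gt0 //.
  rewrite -(@ler_pXn2r _ 2) ?nnegrE ?mulr_ge0 //.
  have := sqr_ge0 M; nra.
have qR_gt0 : 0 < q%:R :> R by rewrite ltr0n.
have := sum_product_dichotomy A.
rewrite card_mx mulnn cF => -[le_p|le_p].
  (* The first alternative bounds the second term of the minimum, the second alternative the
     first. *)
  apply: (@le_trans _ _ ((8 * n%:R)^-1 * Y)).
    by rewrite ler_pM2l ?invr_gt0 ?mulr_gt0 // ge_min lexx orbT.
  apply: le_M; first by rewrite mulr_ge0 ?powR_ge0.
  have -> : Y ^+ 2 = (#|A| * q ^ (n ^ 2))%:R.
    rewrite exprMn -!powR_mulrn ?powR_ge0 // -!powRrM !divfK ?pnatr_eq0 //.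
    by rewrite powRr1 // powR_mulrn // natrM natrX mulrC.
  move: le_p; rewrite -(ler_nat R) natrM [leRHS]natrM => le_p.
  have := sqr_ge0 M; nra.
apply: (@le_trans _ _ ((8 * n%:R)^-1 * X)).
  by rewrite ler_pM2l ?invr_gt0 ?mulr_gt0 // ge_min lexx.
apply: le_M; first by rewrite divr_ge0 ?powR_ge0 ?sqr_ge0.
have -> : X ^+ 2 = #|A|%:R ^+ 4 / (t * q ^ (n ^ 2))%:R.
  rewrite expr_div_n -exprM -[_ `^ _ ^+ 2]powR_mulrn ?powR_ge0 // -powRrM.
  have -> : ((n ^ 2)%:R - 1 / 2) * 2 = (n ^ 2 - 1 + n ^ 2)%N%:R :> R.
    by rewrite natrD natrB //; field.
  by rewrite powR_mulrn // -natrX expnD.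
rewrite ler_pdivrMr ?ltr0n ?muln_gt0 ?t_gt0 //.
(* In the notation below: [#|A| * a3 <= 2 * g * a3 <= 8 * p * s * Q <= 8 * n * p * t * Q]. *)
have {le_p} : (#|A| ^ 4 <= 8 * n * (#|prodset A A| * #|sumset A A|) * (t * q ^ (n ^ 2)))%N.
  rewrite expnS; move: le_p sing_le G_ge.
  set g := #|A :\: _|; set a3 := (_ ^ 3)%N; set s := #|singular _ _|.
  set p := (#|prodset _ _| * _)%N; set Q := (q ^ _)%N => le_p sing_le G_ge.
  have : (#|A| * a3 <= 2 * g * a3)%N by rewrite leq_mul2r G_ge orbT.
  have : (p * Q * s <= p * Q * (n * t))%N by rewrite leq_mul2l sing_le orbT.
  nia.
rewrite -(ler_nat R) natrX => /le_trans; apply.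
by rewrite natrM ler_wpM2r // natrM natrM ler_wpM2l // mulr_ge0.
Qed.
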